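(* Let $H$ be a real Hilbert space, let $\{e_i\}_{i\in\mathbb{N}}$ be a Schauder basis of $H$, and let $\{e'_i\}_{i\in\mathbb{N}}\subset H$ be its biorthogonal system, i.e. $(e'_i,e_j)=\delta_{ij}$ for all $i,j\in\mathbb{N}$. Suppose that a sequence of vectors $f_1,f_2,\ldots\in H$ satisfies the following two conditions: 1) $$\sum_{i,j\in\mathbb{N}}|(e_i,e_j)|\cdot\|f_i-e'_i\|\cdot\|f_j-e'_j\|<\infty;$$ 2) ($\omega$-independence) for every sequence of real numbers $\{\lambda_i\}_{i\in\mathbb{N}}$, the equality $\sum_{i=1}^\infty\lambda_i f_i=0$ implies $\lambda_i=0$ for all $i\in\mathbb{N}$. Then the sequence $\{f_i\}_{i\in\mathbb{N}}$ is a Schauder basis of $H$.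
   Context: $(\cdot,\cdot)$ and $\|\cdot\|$ denote the inner product and norm of $H$, and $\delta_{ij}$ is the Kronecker delta. Infinite sums of vectors are understood as limits of partial sums in the norm of $H$; in condition 2) the equality $\sum_{i=1}^\infty\lambda_i f_i=0$ means that the series converges in norm with sum $0$. A sequence $\{b_i\}_{i\in\mathbb{N}}$ is a Schauder basis of $H$ if every $x\in H$ has a unique expansion $x=\sum_{i=1}^\infty c_i b_i$ with scalars $c_i$, convergent in norm. The biorthogonal system $\{e'_i\}$ of a Schauder basis $\{e_i\}$ of $H$ exists (it represents the coordinate functionals, so $x=\sum_{i=1}^\infty(e'_i,x)e_i$ for all $x\in H$) and is itself a Schauder basis of $H$. *)

(* Defs.v *)
From HB Require Import structures.
From mathcomp Require Import all_boot all_order all_algebra.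
From mathcomp Require Import all_classical all_reals all_analysis.

Set Implicit Arguments.
Unset Strict Implicit.
Unset Printing Implicit Defensive.

Import Order.TTheory GRing.Theory Num.Theory.
Import numFieldNormedType.Exports.

Local Open Scope classical_set_scope.
Local Open Scope ring_scope.

(* MathComp-Analysis has no Hilbert space structure: a real Hilbert space is
   rendered as a complete normed module H over R : realType together with a
   symmetric positive definite bilinear form dot : {dot H for idfun} such that
   norm_from_dot dot holds. *)
Definition norm_from_dot (R : realType) (H : completeNormedModType R)
    (dot : {dot H for idfun}) : Prop :=
  forall x : H, `|x| = Num.sqrt (dot x x).

Definition schauder_basis (R : realType) (H : normedModType R)
    (b : nat -> H) : Prop :=
  forall x : H, exists! c : nat -> R,
    series (fun i => c i *: b i) @ \oo --> x.

Definition omega_independent (R : realType) (H : normedModType R)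
    (f : nat -> H) : Prop :=
  forall l : nat -> R,
    series (fun i => l i *: f i) @ \oo --> (0 : H) -> forall i, l i = 0.

Definition biorthogonal (R : realType) (H : completeNormedModType R)
    (dot : {dot H for idfun}) (e' e : nat -> H) : Prop :=
  forall i j : nat, dot (e' i) (e j) = (i == j)%:R.

(* Main.v *)
Require Import Defs.
From HB Require Import structures.
From mathcomp Require Import all_boot all_order all_algebra.
From mathcomp Require Import all_classical all_reals all_analysis.
From mathcomp Require Import ring lra.

(** Why the theorem holds.

    Put g i = f i - e' i and let T be the operator
      T x = \sum_i (e i, x) g i,
    so that 1 + T sends e' i to f i.  If 1 + T is onto, every y is
      x + T x = \sum_i (e i, x) (e' i + g i) = \sum_i (e i, x) f i
    for some x, and omega-independence makes this expansion unique.
    Three facts give surjectivity.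

    (a) Every x equals \sum_i (e i, x) e' i (dual_basis_expansion).  The partial
    sum operators of the basis e converge pointwise, so they are uniformly
    bounded by Banach-Steinhaus, and so are their adjoints, which are the
    partial sum operators of this dual expansion.  The set of x whose dual
    expansion converges to x is therefore a closed subspace; it contains each
    e' i, and a vector orthogonal to all e' i vanishes since its coordinates in
    the basis e do.

    (b) T is a norm limit of finite rank operators.  By duality and
    Cauchy-Schwarz, the norm of the operator
      x |-> \sum_(m <= i < n) (e i, x) g i
    is at most the square root of the sum of |(e i, e j)| |g i| |g j| over
    m <= i, j < n (rank_one_sum_bound), a tail of the double series assumed to
    converge.  Hence T = S + F with S a strict contraction and F of finite rank
    (rank_one_series_split).

    (c) Fredholm alternative: if S is a strict contraction, F has finite rank
    and 1 + S + F is injective, then 1 + S + F is surjective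
    (fredholm_surjective).  The map 1 + S is onto by the Banach fixed point
    theorem, and what remains is a square linear system.

    Injectivity of 1 + T is where omega-independence enters a second time: if
    x + T x = 0 then \sum_i (e i, x) f i = 0, so all (e i, x) vanish and x = 0
    by (a). *)

Set Implicit Arguments.
Unset Strict Implicit.
Unset Printing Implicit Defensive.

Import Order.TTheory GRing.Theory Num.Theory.
Import numFieldNormedType.Exports.

Local Open Scope classical_set_scope.
Local Open Scope ring_scope.

(** * Inner products *)

Section InnerProduct.
Context (R : realType) (H : completeNormedModType R).
Context (dot : {dot H for idfun}).
Implicit Types x y z : H.

Lemma dotC x y : dot x y = dot y x.
Proof. by rewrite hermC /= expr0 mul1r. Qed.

Lemma dotDl x y z : dot (x + y) z = dot x z + dot y z.
Proof. exact: linearDl. Qed.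

Lemma dotBl x y z : dot (x - y) z = dot x z - dot y z.
Proof. exact: linearBl. Qed.

Lemma dotZl a x z : dot (a *: x) z = a * dot x z.
Proof. exact: linearZl_LR. Qed.

Lemma dotDr x y z : dot z (x + y) = dot z x + dot z y.
Proof. exact: linearDr. Qed.

Lemma dotBr x y z : dot z (x - y) = dot z x - dot z y.
Proof. exact: linearBr. Qed.

Lemma dotZr a x z : dot z (a *: x) = a * dot z x.
Proof. exact: linearZr_LR. Qed.

Lemma dot0r z : dot z 0 = 0.
Proof. exact: linear0r. Qed.

Lemma dot_sumr z (I : Type) (r : seq I) (P : pred I) (F : I -> H) :
  dot z (\sum_(i <- r | P i) F i) = \sum_(i <- r | P i) dot z (F i).
Proof. exact: linear_sumr. Qed.

Lemma dot_suml z (I : Type) (r : seq I) (P : pred I) (F : I -> H) :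
  dot (\sum_(i <- r | P i) F i) z = \sum_(i <- r | P i) dot (F i) z.
Proof. by rewrite dotC dot_sumr; apply: eq_bigr => i _; rewrite dotC. Qed.

Hypothesis dotE : norm_from_dot dot.

Lemma dotxx x : dot x x = `|x| ^+ 2.
Proof.
rewrite dotE sqr_sqrtr //; have [->|x0] := eqVneq x 0; first by rewrite dot0r.
exact/ltW/neq0_dnorm_gt0.
Qed.

Lemma cauchy_schwarz x y : `|dot x y| <= `|x| * `|y|.
Proof.
have [->|y0] := eqVneq y 0; first by rewrite dot0r !normr0 mulr0.
have yp : 0 < `|y| by rewrite normr_gt0.
(* The component of x orthogonal to y, scaled by |y|^2 to avoid a division. *)
have : 0 <= dot (`|y| ^+ 2 *: x - dot x y *: y) (`|y| ^+ 2 *: x - dot x y *: y).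
  by rewrite dotxx sqr_ge0.
rewrite !(dotBl, dotBr, dotZl, dotZr) (dotC y x) !dotxx => h.
rewrite -ler_sqr ?nnegrE ?mulr_ge0 // real_normK ?num_real // exprMn.
rewrite -subr_ge0 -(pmulr_rge0 _ (exprn_gt0 2 yp)).
by apply: le_trans h _; rewrite le_eqVlt; apply/orP; left; apply/eqP; ring.
Qed.

(** Taking y = z suffices; the bound is applied to vectors z whose pairing with
    any y is estimated by moving an operator onto y. *)
Lemma dual_bound (C : R) z :
  0 <= C -> (forall y, dot z y <= C * `|y|) -> `|z| <= C.
Proof.
move=> C0 /(_ z); rewrite dotxx.
have [->|z0] := eqVneq z 0; first by rewrite normr0.
by rewrite expr2 ler_pM2r // normr_gt0.
Qed.

Lemma cvg_dotr (u : nat -> H) x y :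
  u @ \oo --> x -> (fun n => dot y (u n)) @ \oo --> dot y x.
Proof.
move=> ux; apply/cvgrPdist_lt => eps e0.
have y1 : 0 < `|y| + 1 by rewrite ltr_wpDl.
move/cvgrPdist_lt: ux => /(_ _ (divr_gt0 e0 y1)); apply: filterS => n.
rewrite ltr_pdivlMr // => h.
rewrite -dotBr; apply: le_lt_trans (cauchy_schwarz _ _) _.
by apply: le_lt_trans h; rewrite mulrC ler_wpM2l // lerDl.
Qed.

Lemma parallelogram x y :
  `|x - y| ^+ 2 = 2 * `|x| ^+ 2 + 2 * `|y| ^+ 2 - `|x + y| ^+ 2.
Proof.
by rewrite -!dotxx !(dotBl, dotBr, dotDl, dotDr) (dotC y x); ring.
Qed.

(** This is the projection theorem for closed subspaces.  A sequence in L that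
    minimizes the distance to x is Cauchy by the parallelogram law, since the
    midpoints of its terms also lie in L; its limit p is the nearest point of L,
    hence x - p is orthogonal to L and so x = p. *)
Lemma closed_subspace_setT (L : set H) : closed L -> L 0 ->
  (forall a x y, L x -> L y -> L (a *: x + y)) ->
  (forall x, (forall l, L l -> dot l x = 0) -> x = 0) -> L = setT.
Proof.
move=> clL L0 Llin Lperp; apply/seteqP; split=> // x _.
pose D := [set `|x - l| ^+ 2 | l in L].
have Dinf : has_inf D.
  split; first by exists (`|x - 0| ^+ 2), 0.
  by exists 0 => _ [l _ <-]; exact: sqr_ge0.
pose d := inf D.
have dle l : L l -> d <= `|x - l| ^+ 2.
  by move=> Ll; apply: ge_inf; [exact: Dinf.2 | exists l].
have /choice[l lP] :
    forall n : nat, exists l, L l /\ `|x - l| ^+ 2 < d + n.+1%:R^-1.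
  move=> n; have [|_ [l Ll <-] ?] := @inf_adherent _ D n.+1%:R^-1 _ Dinf.
    by rewrite invr_gt0.
  by exists l.
have lcau n m : (n <= m)%N -> `|l n - l m| ^+ 2 < 4 * n.+1%:R^-1.
  move=> nm.
  have -> : l n - l m = (x - l m) - (x - l n).
    by rewrite opprB [RHS]addrC addrA subrK.
  rewrite parallelogram.
  have -> : (x - l m) + (x - l n) = 2 *: (x - 2^-1 *: (l m + l n)).
    rewrite scalerBr scalerA divff ?pnatr_eq0 // scale1r scaler_nat mulr2n.
    by rewrite opprD addrACA.
  rewrite normrZ ger0_norm // exprMn.
  have Lm : L (2^-1 *: (l m + l n)).
    rewrite -[_ *: _]addr0; apply: (Llin) => //.
    rewrite -[l m]scale1r.
    by apply: (Llin); [exact: (lP m).1 | exact: (lP n).1].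
  have := dle _ Lm; have := (lP m).2; have := (lP n).2.
  have : m.+1%:R^-1 <= n.+1%:R^-1 :> R.
    by rewrite lef_pV2 ?posrE ?ltr0n // ler_nat.
  rewrite -natrX.
  move: (`|x - _ *: _| ^+ 2) (`|_ - l n| ^+ 2) (`|x - l m| ^+ 2) => A B C.
  by move: m.+1%:R^-1 n.+1%:R^-1 => a b *; lra.
have : cvg (l @ \oo).
  apply/cauchy_cvgP/cauchy_exP => e e0; rewrite /fmapE.
  have [n ne] : exists n, 4 * n.+1%:R^-1 < e ^+ 2.
    have e2 : 0 < e ^+ 2 by rewrite exprn_gt0.
    exists (Num.truncn (4 / e ^+ 2)).
    by rewrite ltr_pdivrMr // mulrC -ltr_pdivrMr // truncnS_gt.
  exists (l n); exists n => // m nm; rewrite -ball_normE /=.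
  rewrite -ltr_sqr ?nnegrE // ?(ltW e0) //; exact: lt_trans (lcau _ _ nm) ne.
move=> /cvg_ex[p l_cvg].
have Lp : L p.
  apply: (@closed_cvg _ _ \oo _ l) l_cvg => //.
  by apply: nearW => n; exact: (lP n).1.
have pd : `|x - p| ^+ 2 <= d.
  have h1 : (fun n => `|x - l n| ^+ 2) @ \oo --> `|x - p| ^+ 2.
    have h : (fun n => `|x - l n|) @ \oo --> `|x - p|.
      by apply: cvg_norm; apply: cvgB => //; exact: cvg_cst.
    by under eq_fun do rewrite expr2; rewrite expr2; apply: cvgM.
  have h2 : (fun n => d + n.+1%:R^-1) @ \oo --> d + 0.
    by apply: cvgD; [exact: cvg_cst | exact: cvg_harmonic].
  rewrite addr0 in h2; apply: ler_cvg_to h1 h2 _.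
  by apply: nearW => n; exact/ltW/(lP n).2.
suff /Lperp/eqP : forall v, L v -> dot v (x - p) = 0.
  by rewrite subr_eq0 => /eqP ->.
move=> v Lv; have [->|v0] := eqVneq v 0; first by rewrite dotC dot0r.
have vp : 0 < `|v| ^+ 2 by rewrite exprn_gt0 ?normr_gt0.
(* Moving from p along v by this s minimizes the distance to x on that line:
   the squared distance drops by (v, x - p)^2 / |v|^2. *)
pose s := dot v (x - p) / `|v| ^+ 2.
have := le_trans pd (dle _ (Llin s _ _ Lv Lp)).
have -> : x - (s *: v + p) = (x - p) - s *: v by rewrite opprD addrA addrAC.
rewrite {}/s -2!dotxx; move: (x - p) => w.
rewrite !(dotBl, dotBr, dotZl, dotZr) (dotC w v) !dotxx -subr_ge0 => h.
have : dot v w ^+ 2 / `|v| ^+ 2 <= 0.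
  rewrite -oppr_ge0; apply: le_trans h _; rewrite le_eqVlt; apply/orP; left.
  by apply/eqP; field; rewrite -normr_eq0 in v0.
rewrite pmulr_lle0 ?invr_gt0 // => h2.
by apply/eqP; rewrite -sqrf_eq0 eq_le h2 sqr_ge0.
Qed.

End InnerProduct.

(** * Series of rank one operators *)

Section RankOneSeries.
Context (R : realType) (H : completeNormedModType R).
Context (dot : {dot H for idfun}).
Implicit Types (u v : nat -> H) (x y : H).

(** Basis expansions, dual expansions and the perturbation T are all sums of
    rank one operators; this common form makes exchanging u and v the passage
    to the adjoint. *)
Definition rank_one_series u v x : nat -> H :=
  series (fun i => dot (u i) x *: v i).

Lemma rank_one_series_linear u v n a x y :
  rank_one_series u v (a *: x + y) n =
  a *: rank_one_series u v x n + rank_one_series u v y n.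
Proof.
rewrite /rank_one_series /series /= scaler_sumr -big_split.
by apply: eq_bigr => i _ /=; rewrite dotDr dotZr scalerDl scalerA.
Qed.

Lemma rank_one_series_eq0 u v n x :
  (forall i, dot (u i) x = 0) -> rank_one_series u v x n = 0.
Proof.
by move=> ux0; rewrite /rank_one_series /series /= big1 // => i _;
  rewrite ux0 scale0r.
Qed.

Lemma rank_one_series_cvg0 u v x :
  (forall i, dot (u i) x = 0) -> rank_one_series u v x @ \oo --> (0 : H).
Proof.
move=> ux0; apply: cvg_near_cst; apply: nearW => n.
exact: rank_one_series_eq0.
Qed.

Lemma rank_one_series_adjoint u v n x y :
  dot (rank_one_series u v x n) y = dot x (rank_one_series v u y n).
Proof.
rewrite /rank_one_series /series /= dot_suml dot_sumr.
by apply: eq_bigr => i _; rewrite dotZl dotZr mulrC (dotC _ x).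
Qed.

End RankOneSeries.

(** * The dual basis expansion *)

Section DualBasis.
Context (R : realType) (H : completeNormedModType R).
Context (dot : {dot H for idfun}) (dotE : norm_from_dot dot).
Context (e e' : nat -> H) (ee' : biorthogonal dot e' e).
Implicit Types x y : H.

Lemma biorthogonal_coef (c : nat -> R) x (i : nat) :
  series (fun k => c k *: e k) @ \oo --> x -> c i = dot (e' i) x.
Proof.
move=> /(cvg_dotr dotE (y := e' i)); apply: cvg_unique => //.
(* Partial sums of more than i terms already have i-th coordinate c i. *)
apply: cvg_near_cst; exists i.+1 => // n /= ni.
rewrite /series /= big_mkord dot_sumr (bigD1 (Ordinal ni)) //=.
rewrite dotZr ee' eqxx mulr1 big1 ?addr0 // => k ki.
rewrite dotZr ee' (_ : (i == k) = false) ?mulr0 //.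
by apply/negbTE; apply: contraNneq ki => ik; apply/eqP/val_inj.
Qed.

Hypothesis e_basis : schauder_basis e.

Lemma basis_expansion x : rank_one_series dot e' e x @ \oo --> x.
Proof.
have [c [cx _]] := e_basis x.
rewrite [X in X @ _](_ : _ = series (fun k => c k *: e k)) //.
apply/funext => n; apply: eq_bigr => i _.
by rewrite (biorthogonal_coef i cx).
Qed.

Lemma basis_constant :
  exists2 C, 0 <= C & forall n x, `|rank_one_series dot e' e x n| <= C * `|x|.
Proof.
pose P n x := rank_one_series dot e' e x n.
suff : uniform_bounded (range P).
  move=> /(_ 1)[M MP]; have M0 : 0 <= M.
    by apply: le_trans (MP (P 0) _ 0 _); rewrite ?normr0 //; exists 0%N.
  exists M => // n x; have [->|x0] := eqVneq x 0.
    by rewrite rank_one_series_eq0 ?normr0 ?mulr0 // => i; rewrite dot0r.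
  have nx0 : 0 < `|x| by rewrite normr_gt0.
  have Pn0 : P n 0 = 0.
    by apply: rank_one_series_eq0 => i; rewrite dot0r.
  have -> : rank_one_series dot e' e x n = `|x| *: P n (`|x|^-1 *: x).
    rewrite -[_^-1 *: x]addr0 {1}/P rank_one_series_linear -/(P n 0) Pn0 addr0.
    by rewrite scalerA divff ?scale1r // lt0r_neq0.
  rewrite normrZ normr_id mulrC ler_wpM2r //; apply: MP; first by exists n.
  by rewrite normrZ gtr0_norm ?invr_gt0 // mulVf // lt0r_neq0.
apply: Banach_Steinhauss.
- move=> _ [n _ <-].
  split; last by move=> a x y; exact: rank_one_series_linear.
  move=> r; exists (\sum_(0 <= i < n) `|e' i| * r * `|e i|) => x xr.
  apply: le_trans (ler_norm_sum _ _ _) _; apply: ler_sum => i _.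
  rewrite normrZ ler_wpM2r //; apply: le_trans (cauchy_schwarz dotE _ _) _.
  by rewrite ler_wpM2l.
- move=> x; have : cvg (rank_one_series dot e' e x @ \oo).
    by apply/cvg_ex; exists x; exact: basis_expansion.
  move=> /cvg_seq_bounded[M [_ MP]]; exists (M + 1) => _ [n _ <-].
  by apply: (MP (M + 1) _ n) => //; rewrite ltrDl.
Qed.

(** The dual partial sums are adjoint to those of e, hence share their uniform
    bound; so convergence on the vectors e' i, whose orthogonal complement is
    trivial, propagates to the whole space. *)
Lemma dual_basis_expansion x : rank_one_series dot e e' x @ \oo --> x.
Proof.
pose Q n y := rank_one_series dot e e' y n.
have [C C0 PC] := basis_constant.
have QC n y : `|Q n y| <= C * `|y|.
  apply: (dual_bound dotE); first by rewrite mulr_ge0.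
  move=> z; rewrite rank_one_series_adjoint; apply: le_trans (ler_norm _) _.
  apply: le_trans (cauchy_schwarz dotE _ _) _.
  by rewrite (mulrC C) -mulrA ler_wpM2l.
pose L := [set y | Q ^~ y @ \oo --> y].
suff : L = setT by move=> LT; have : L x by rewrite LT.
have e'L i : L (e' i).
  apply: cvg_near_cst; exists i.+1 => // n /= ni.
  rewrite /Q /rank_one_series /series /= big_mkord (bigD1 (Ordinal ni)) //=.
  rewrite dotC ee' eqxx scale1r big1 ?addr0 // => k ki.
  rewrite dotC ee' (_ : (i == k) = false) ?scale0r //.
  by apply/negbTE; apply: contraNneq ki => ik; apply/eqP/val_inj.
apply: (closed_subspace_setT dotE).
- move=> y yL; apply/cvgrPdist_lt => eps eps0.
  (* |y - Q n y| <= (1 + C) |y - u| + |u - Q n u|, and each of |y - u| and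
     |u - Q n u| is made smaller than eps / (C + 2). *)
  have C2 : 0 < C + 2 by rewrite ltr_wpDl.
  have [u [Lu /=]] := yL _ (nbhsx_ballx y _ (divr_gt0 eps0 C2)).
  rewrite -ball_normE /= ltr_pdivlMr // => yu.
  move/cvgrPdist_lt : Lu => /(_ _ (divr_gt0 eps0 C2)); apply: filterS => n.
  rewrite ltr_pdivlMr // => un.
  have -> : Q n y = Q n u + Q n (y - u).
    by rewrite -{1}(subrK u y) -[y - u in LHS]scale1r [LHS]rank_one_series_linear
      scale1r addrC.
  have -> : y - (Q n u + Q n (y - u)) = (y - u) + (u - Q n u) - Q n (y - u).
    by rewrite addrA subrK opprD addrA.
  apply: le_lt_trans (ler_normB _ _) _.
  apply: le_lt_trans (lerD (ler_normD _ _) (QC n _)) _.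
  by rewrite -(ltr_pM2r C2); move: yu un; move: `|y - u| `|u - _| => r s; nra.
- by apply: rank_one_series_cvg0 => i; rewrite dot0r.
- move=> a u v Lu Lv; rewrite /L /=.
  under eq_fun do rewrite [Q _ _]rank_one_series_linear.
  by apply: cvgD => //; apply: cvgZl_tmp.
- move=> y yL.
  have P0 : rank_one_series dot e' e y @ \oo --> (0 : H).
    by apply: rank_one_series_cvg0 => i; exact: yL.
  exact: (cvg_unique (@norm_hausdorff _ H) (@basis_expansion y) P0).
Qed.

End DualBasis.

(** * Approximating the perturbation by finite rank operators *)

(** A square block of indices in [m, n) contributes at most the increment from
    m to n of the sums over initial squares, which converge. *)
Lemma summable_square_tail (R : realType) (a : nat * nat -> R) (eps : R) :
  (forall ij, 0 <= a ij) -> (\esum_(ij in [set: nat * nat]) (a ij)%:E < +oo)%E ->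
  0 < eps -> exists N, forall m n, (N <= m)%N ->
    \sum_(m <= i < n) \sum_(m <= j < n) a (i, j) < eps.
Proof.
move=> a0 afin eps0.
pose s n := \sum_(0 <= i < n) \sum_(0 <= j < n) a (i, j).
have s_tail m n : (m <= n)%N ->
    s m + \sum_(m <= i < n) \sum_(m <= j < n) a (i, j) <= s n.
  move=> mn; rewrite /s [leRHS](big_cat_nat (leq0n m) mn) //=; apply: lerD.
    apply: ler_sum => i _; rewrite [leRHS](big_cat_nat (leq0n m) mn) //= lerDl.
    by apply: sumr_ge0.
  apply: ler_sum => i _; rewrite [leRHS](big_cat_nat (leq0n m) mn) //= lerDr.
  by apply: sumr_ge0.
have snd : nondecreasing_seq s.
  move=> m n mn; apply: le_trans (s_tail _ _ mn); rewrite lerDl.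
  by do 2!(apply: sumr_ge0 => ? _).
have sub n : s n <= fine (\esum_(ij in [set: nat * nat]) (a ij)%:E).
  rewrite -lee_fin fineK; last first.
    by rewrite ge0_fin_numE // esum_ge0 // => ij _; rewrite lee_fin.
  apply: esum_ge; exists (`I_n `*` `I_n).
    by split => //; apply: finite_setX; exact: finite_II.
  have -> : (\sum_(ij \in `I_n `*` `I_n) (a ij)%:E =
             \sum_(i \in `I_n) \sum_(j \in `I_n) (a (i, j))%:E)%R.
    by rewrite pair_fsbig //=; apply: eq_fsbigr => -[].
  rewrite -fsbig_ord /s big_mkord -sumEFin; apply: lee_sum => i _.
  by rewrite -fsbig_ord big_mkord -sumEFin.
have scvg : cvgn s.
  by apply: nondecreasing_is_cvgn => //; eexists => _ [n _ <-]; exact: sub.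
have [N _ NP] := (cvgrPdist_lt _ _).1 scvg _ eps0.
exists N => m n Nm; have [nm|/ltnW mn] := leqP n m; first by rewrite big_geq.
have := NP m Nm; rewrite ger0_norm ?subr_ge0 ?nondecreasing_cvgn_le //.
apply: le_lt_trans; rewrite lerBrDl; apply: le_trans (s_tail _ _ mn) _.
exact: nondecreasing_cvgn_le.
Qed.

Section FiniteRankApproximation.
Context (R : realType) (H : completeNormedModType R).
Context (dot : {dot H for idfun}) (dotE : norm_from_dot dot).
Context (e g : nat -> H).
Implicit Types x y : H.

(** Pairing with y moves the operator to w = \sum_i (g i, y) e i, and expanding
    |w|^2 yields the Gram entries (e i, e j). *)
Lemma rank_one_sum_bound (m n : nat) x :
  `|\sum_(m <= i < n) dot (e i) x *: g i| <=
  Num.sqrt (\sum_(m <= i < n) \sum_(m <= j < n)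
              `|dot (e i) (e j)| * `|g i| * `|g j|) * `|x|.
Proof.
set A := Num.sqrt _.
apply: (dual_bound dotE); first by rewrite mulr_ge0 // sqrtr_ge0.
move=> y; set w := \sum_(m <= i < n) dot (g i) y *: e i.
have -> : dot (\sum_(m <= i < n) dot (e i) x *: g i) y = dot w x.
  by rewrite !dot_suml; apply: eq_bigr => i _; rewrite !dotZl mulrC.
apply: le_trans (ler_norm _) _; apply: le_trans (cauchy_schwarz dotE _ _) _.
rewrite mulrAC ler_wpM2r // -ler_sqr ?nnegrE ?mulr_ge0 ?sqrtr_ge0 // exprMn.
rewrite sqr_sqrtr; last by do 2!(apply: sumr_ge0 => ? _); rewrite !mulr_ge0.
rewrite -(dotxx dotE) dot_suml mulr_suml; apply: ler_sum => i _.
rewrite dotZl dot_sumr mulr_sumr mulr_suml; apply: ler_sum => j _.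
rewrite dotZr; apply: le_trans (ler_norm _) _; rewrite !normrM.
have gy k := cauchy_schwarz dotE (g k) y.
have -> : `|dot (e i) (e j)| * `|g i| * `|g j| * `|y| ^+ 2 =
  (`|g i| * `|y|) * ((`|g j| * `|y|) * `|dot (e i) (e j)|) by ring.
by rewrite ler_pM ?ler_wpM2r ?mulr_ge0.
Qed.

Hypothesis summable : (\esum_(ij in [set: nat * nat])
  (`|dot (e ij.1) (e ij.2)| * `|g ij.1| * `|g ij.2|)%:E < +oo)%E.

Lemma rank_one_tail_bound (eps : R) : 0 < eps ->
  exists N, forall m n x, (N <= m)%N ->
    `|\sum_(m <= i < n) dot (e i) x *: g i| <= eps * `|x|.
Proof.
move=> eps0.
have a0 ij : 0 <= `|dot (e ij.1) (e ij.2)| * `|g ij.1| * `|g ij.2|.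
  by rewrite !mulr_ge0.
have [N NP] := summable_square_tail a0 summable (exprn_gt0 2 eps0).
exists N => m n x Nm; apply: le_trans (rank_one_sum_bound _ _ _) _.
rewrite ler_wpM2r // -(ger0_norm (ltW eps0)) -sqrtr_sqr ler_wsqrtr //.
exact/ltW/NP.
Qed.

Lemma rank_one_series_cvg x : cvg (rank_one_series dot e g x @ \oo).
Proof.
apply/cauchy_cvgP/cauchy_seriesP => eps eps0.
have x1 : 0 < `|x| + 1 by rewrite ltr_wpDl.
have [N NP] := rank_one_tail_bound (divr_gt0 eps0 x1).
exists ([set m | (N <= m)%N], setT) => /=.
  by split; [exists N | exact: filterT].
move=> [m n] [/= Nm _]; apply: le_lt_trans (NP _ _ _ Nm) _.
by rewrite mulrAC ltr_pdivrMr // ltr_pM2l // ltrDl.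
Qed.

Lemma rank_one_series_split (q : R) : 0 < q ->
  exists (N : nat) (S : {linear H -> H}),
    (forall x, `|S x| <= q * `|x|) /\
    forall x, rank_one_series dot e g x @ \oo -->
              S x + \sum_(i < N) dot (e i) x *: g i.
Proof.
move=> q0; have [N NP] := rank_one_tail_bound q0.
pose T x n : H := rank_one_series dot e g x n.
pose S x := lim (T x @ \oo) - T x N.
have TS x : (fun n => T x n - T x N) @ \oo --> S x.
  by apply: cvgB; [exact: rank_one_series_cvg | exact: cvg_cst].
have Slin : linear S.
  move=> a x y; apply: (cvg_unique (@norm_hausdorff _ H) (@TS (a *: x + y))).
  have -> : (fun n => T (a *: x + y) n - T (a *: x + y) N) =
            (fun n => a *: (T x n - T x N) + (T y n - T y N)).
    apply/funext => n.
    by rewrite /T !rank_one_series_linear scalerBr opprD addrACA.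
  by apply: cvgD => //; apply: cvgZl_tmp.
pose SL : {linear H -> H} := HB.pack S (GRing.isLinear.Build _ _ _ _ _ Slin).
exists N, SL; split=> x.
  apply: (ler_cvg_to (cvg_norm (@TS x)) (cvg_cst (q * `|x|))).
  exists N => // n /= Nn; rewrite /T sub_series_geq //; exact: NP.
rewrite /= -(big_mkord xpredT (fun i => dot (e i) x *: g i)) subrK.
exact: rank_one_series_cvg.
Qed.

End FiniteRankApproximation.

(** * The Fredholm alternative *)

Section Fredholm.
Context (R : realType) (H : completeNormedModType R).
Context (S : {linear H -> H}) (q : R).
Hypotheses (q_lt1 : q < 1) (S_contr : forall x : H, `|S x| <= q * `|x|).

(** Solutions of x + S x = y are the fixed points of x |-> y - S x. *)
Lemma contraction_perturbation_surjective (y : H) : exists x, x + S x = y.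
Proof.
have [q0|qn] := leP 0 q; last first.
  (* A negative q forces the space to be trivial. *)
  exists y; suff -> : y = 0 by rewrite linear0 addr0.
  apply/eqP; rewrite -normr_eq0 eq_le normr_ge0 andbT.
  rewrite -(nmulr_rge0 _ qn); exact: le_trans (S_contr _).
pose f := [fun of 'totalfun_setT (fun x => y - S x)].
have [|||x _ xf] := @banach_fixed_point R H setT f.
- exists (NngNum q0); split => // -[u v] _ /=.
  rewrite opprB addrC addrA subrK -linearB (distrC u).
  exact: S_contr.
- exact: closedT.
- by exists 0.
by exists x; have {1}-> : x = y - S x := xf; rewrite subrK.
Qed.

(** Let h j and z solve h j + S h j = g j and z + S z = y.  For a vector
    x = z - \sum_j a j h j the equation becomes (e i, x) = a i for all i, a
    square linear system in a; its matrix B is invertible because a kernel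
    element a would give the solution - \sum_j a j h j of the homogeneous
    equation. *)
Lemma fredholm_surjective (dot : {dot H for idfun}) (n : nat)
    (e g : 'I_n -> H) :
  (forall x, x + S x + \sum_i dot (e i) x *: g i = 0 -> x = 0) ->
  forall y, exists x, x + S x + \sum_i dot (e i) x *: g i = y.
Proof.
move=> inj y; have surj := contraction_perturbation_surjective.
have /choice[h hg] j : exists z, z + S z = g j by exact: surj.
have [z zy] := surj y.
(* Row vector convention: unknowns multiply B from the left, so the row index
   j belongs to h and the column index i to e. *)
pose B : 'M[R]_n := 1%:M + \matrix_(j, i) dot (e i) (h j).
have BE (a : 'rV_n) i : (a *m B) 0 i = a 0 i + dot (e i) (\sum_j a 0 j *: h j).
  rewrite mulmxDr mulmx1 !mxE dot_sumr; congr (_ + _).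
  by apply: eq_bigr => j _; rewrite mxE dotZr.
have linS (a : 'rV_n) : let w := \sum_j a 0 j *: h j in
    w + S w = \sum_j a 0 j *: g j.
  rewrite /= linear_sum -big_split; apply: eq_bigr => j _ /=.
  by rewrite linearZ -scalerDr hg.
have Bunit : B \in unitmx.
  rewrite -row_free_unit; apply: inj_row_free => a aB0.
  have /eqP w0 : - \sum_j a 0 j *: h j = 0.
    apply: inj; rewrite linearN -opprD linS.
    apply/eqP; rewrite addrC subr_eq0; apply/eqP.
    apply: eq_bigr => i _; congr (_ *: _).
    have /eqP := BE a i; rewrite aB0 mxE eq_sym addr_eq0 => /eqP ->.
    by rewrite linearNr.
  apply/rowP => i; have := BE a i; rewrite aB0 mxE.
  by move: w0; rewrite oppr_eq0 => /eqP ->; rewrite dot0r addr0 => <-.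
pose b : 'rV[R]_n := \row_i dot (e i) z.
pose a := b *m invmx B; pose w := \sum_j a 0 j *: h j; exists (z - w).
have aE i : dot (e i) (z - w) = a 0 i.
  by have := BE a i; rewrite mulmxKV // mxE dotBr => ->; rewrite addrK.
have -> : \sum_i dot (e i) (z - w) *: g i = \sum_i a 0 i *: g i.
  by apply: eq_bigr => i _; rewrite aE.
by rewrite linearB addrACA -opprD linS zy subrK.
Qed.

End Fredholm.

(** * Stability of the dual basis *)

Theorem theorem1 (R : realType) (H : completeNormedModType R)
    (dot : {dot H for idfun}) (dotE : norm_from_dot dot)
    (e e' f : nat -> H)
    (e_basis : schauder_basis e)
    (ee'_biorth : biorthogonal dot e' e)
    (f_close : (\esum_(ij in [set: nat * nat])
       (`|dot (e ij.1) (e ij.2)| * `|f ij.1 - e' ij.1| * `|f ij.2 - e' ij.2|)%:E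
       < +oo)%E)
    (f_indep : omega_independent f) :
  schauder_basis f.
Proof.
pose g i := f i - e' i.
have half0 : 0 < 2^-1 :> R by rewrite invr_gt0.
have half1 : 2^-1 < 1 :> R by rewrite invf_lt1 // ltr1n.
have [N [S [Shalf gS]]] := rank_one_series_split (g := g) dotE f_close half0.
have dual := dual_basis_expansion dotE ee'_biorth e_basis.
have fS x : rank_one_series dot e f x @ \oo -->
    x + S x + \sum_(i < N) dot (e i) x *: g i.
  have -> : rank_one_series dot e f x =
    rank_one_series dot e e' x \+ rank_one_series dot e g x.
    apply/funext => n; rewrite /rank_one_series /series /= -big_split.
    by apply: eq_bigr => i _ /=; rewrite -scalerDr addrC subrK.
  by rewrite -addrA; apply: cvgD; [exact: dual | exact: gS].
have surj y : exists x, x + S x + \sum_(i < N) dot (e i) x *: g i = y.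
  apply: (fredholm_surjective half1 Shalf (e := fun i : 'I_N => e i)
            (g := fun i : 'I_N => g i)) => x Ax0.
  have ex0 : forall i, dot (e i) x = 0.
    by apply: f_indep; rewrite -[X in _ --> X]Ax0; exact: fS.
  apply: (cvg_unique (@norm_hausdorff _ H) (dual x)).
  exact: rank_one_series_cvg0.
move=> y; have [x <-] := surj y.
exists (fun i => dot (e i) x); split=> [|c cy]; first exact: fS.
apply/funext => i; apply/eqP; rewrite -subr_eq0; apply/eqP.
move: i; apply: (f_indep (fun i => dot (e i) x - c i)).
have -> : series (fun i => (dot (e i) x - c i) *: f i) =
    rank_one_series dot e f x \- series (fun i => c i *: f i).
  apply/funext => n; rewrite /rank_one_series /series /= -sumrB.
  by apply: eq_bigr => i _; rewrite scalerBl.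
rewrite -[X in _ --> X](subrr (x + S x + \sum_(i < N) dot (e i) x *: g i)).
by apply: cvgB => //; exact: fS.
Qed.
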